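(* Let $\Bbbk$ be a field of characteristic different from $2$, let $A$ be a right $H(2)$-comodule algebra and $B=A^{coH(2)}$. The extension $B\subseteq A$ is $H(2)$-cleft if and only if there exist elements $a,b\in A$ such that $$ab=1_A,\quad ba=-1_A,\quad \rho_A(a)=a\otimes x,\quad\rho_A(b)=b\otimes x.$$ In this case, the following hold: (1) The maps $\gamma:H(2)\to A$, $\gamma(1)=1_A$, $\gamma(x)=a$ and $\delta:H(2)\to A$, $\delta(1)=1_A$, $\delta(x)=b$ form a cleaving system; (2) $A$ is free as left $B$-module with basis $\{1_A,a\}$; (3) The elements $c=a^2$, $d=-b^2$ are invertible in $B$ and $c^{-1}=d$; (4) The weak action of $H(2)$ on $B$ and the cocycle corresponding to the crossed product structure are $$1\cdot e=e,\quad x\cdot e=aeb\quad(e\in B),\qquad \sigma(x,x)=c\ \text{ and }\sigma\text{ trivial elsewhere, i.e. }\sigma(1,1)=\sigma(1,x)=\sigma(x,1)=1_A.$$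
   Context: All vector spaces, algebras and tensor products are over the field $\Bbbk$; $\rho(a)=a_0\otimes a_1$ denotes coactions. $H(2)$ is the coquasi-Hopf algebra with basis $\{1,x\}$, $x$ grouplike, $x^2=1$ (as algebra and coalgebra it is the group algebra $\Bbbk[C_2]$), reassociator $\omega\in(H(2)^{\otimes 3})^*$ given by $\omega(x,x,x)=-1$ and $\omega=1$ on all other triples of basis elements, antipode $S=\mathrm{id}$, $\beta(1)=\beta(x)=1$, $\alpha(1)=1$, $\alpha(x)=-1$. Right $H$-comodule algebra ($H=H(2)$): a right $H$-comodule $(A,\rho_A)$ with an $H$-colinear multiplication ($\rho_A(ab)=a_0b_0\otimes a_1b_1$) and an $H$-colinear two-sided unit $1_A$, such that $(ab)c=a_0(b_0c_0)\,\omega(a_1,b_1,c_1)$ for all $a,b,c\in A$. $A^{coH}=\{a\in A:\rho_A(a)=a\otimes 1\}$ is an associative unital algebra. Cleft: $B\subseteq A$ is $H$-cleft if there is a cleaving system $(\gamma,\delta)$, i.e. a right $H$-colinear map $\gamma:H\to A$ and a linear map $\delta:H\to A$ such that for all $h\in H$: $\rho_A(\delta(h))=\delta(h_2)\otimes S(h_1)$, $\delta(h_1)\gamma(h_2)=\alpha(h)1_A$, $\gamma(h_1)\beta(h_2)\delta(h_3)=\varepsilon(h)1_A$. Crossed product structure: for a cleaving system $(\gamma,\delta)$ with $\gamma(1)=1_A$, the map $\nu:B\otimes H\to A$, $\nu(b\otimes h)=b\gamma(h)$, is a left $B$-linear right $H$-colinear isomorphism; the corresponding weak action $\cdot:H\otimes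 B\to B$ and cocycle $\sigma:H\otimes H\to B$ are those for which $\nu$ is an isomorphism of algebras from the crossed product $B\overline{\#}_{\sigma}H$, i.e. $B\otimes H$ with multiplication $(r\otimes h)(s\otimes g)=r(h_1\cdot s)\sigma(h_2,g_1)\otimes h_3g_2$; explicitly $h\cdot b=\gamma(h_1)\,b\,\delta(h_3)\beta(h_2)$ and $\sigma(h,g)=[\gamma(h_1)\gamma(g_1)]\,\delta(h_3g_3)\,\beta(h_2g_2)$. *)

(* Defs.v *)
From HB Require Import structures.
From mathcomp Require Import all_boot all_order all_algebra.
From mathcomp Require Import ring.

Set Implicit Arguments.
Unset Strict Implicit.
Unset Printing Implicit Defensive.

Import GRing.Theory.
Local Open Scope ring_scope.

Reserved Notation "v \ox h" (at level 40, left associativity).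
Reserved Notation "a ** b" (at level 40, left associativity).

(* C_2 is (bool, addb), with neutral element false and generator true, and an
   element of H(2) is its pair of coordinates on the basis {1, x}.  H2 is an
   alias because {ffun bool -> k^o} already carries the pointwise product,
   which is not the product of the group algebra. *)
Definition H2 (k : fieldType) : Type := {ffun bool -> k^o}.

HB.instance Definition _ (k : fieldType) :=
  GRing.Lmodule.copy (H2 k) {ffun bool -> k^o}.

Section H2Algebra.
Variable k : fieldType.
Implicit Types (h g l : H2 k) (i j : bool).

Definition hcoord h i : k := (h : {ffun bool -> k^o}) i.

Definition H2basis i : H2 k := [ffun j => (i == j)%:R : k].

Definition H2mul h g : H2 k :=
  [ffun i => \sum_(j : bool) hcoord h j * hcoord g (j (+) i) : k].

Lemma H2P h g : hcoord h =1 hcoord g -> h = g.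
Proof. by move=> e; apply/ffunP. Qed.

Lemma hcoordM h g i : hcoord (H2mul h g) i =
  hcoord h true * hcoord g (true (+) i) + hcoord h false * hcoord g i.
Proof. by rewrite /hcoord ffunE big_bool. Qed.

Lemma hcoordD h g i : hcoord (h + g) i = hcoord h i + hcoord g i.
Proof. by rewrite /hcoord ffunE. Qed.

Lemma hcoordZ (c : k) h i : hcoord (c *: h) i = c * hcoord h i.
Proof. by rewrite /hcoord ffunE. Qed.

Lemma hcoord0 i : hcoord 0 i = 0.
Proof. by rewrite /hcoord ffunE. Qed.

Lemma hcoord_basis i j : hcoord (H2basis i) j = (i == j)%:R.
Proof. by rewrite /hcoord ffunE. Qed.

Lemma H2mulA : associative H2mul.
Proof. by move=> h g l; apply: H2P; case; rewrite !hcoordM /=; ring. Qed.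

Lemma H2mul1l : left_id (H2basis false) H2mul.
Proof. by move=> h; apply: H2P; case; rewrite !hcoordM !hcoord_basis /=; ring. Qed.

Lemma H2mul1r : right_id (H2basis false) H2mul.
Proof. by move=> h; apply: H2P; case; rewrite !hcoordM !hcoord_basis /=; ring. Qed.

Lemma H2mulDl : left_distributive H2mul +%R.
Proof. by move=> h g l; apply: H2P => i; rewrite !(hcoordM, hcoordD) /=; ring. Qed.

Lemma H2mulDr : right_distributive H2mul +%R.
Proof. by move=> h g l; apply: H2P => i; rewrite !(hcoordM, hcoordD) /=; ring. Qed.

Lemma H2one_neq0 : H2basis false != 0.
Proof.
apply/eqP => /(congr1 (hcoord^~ false)); rewrite hcoord_basis hcoord0 eqxx.
by apply/eqP; exact: oner_neq0.
Qed.

HB.instance Definition _ := GRing.Zmodule_isNzRing.Build (H2 k)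
  H2mulA H2mul1l H2mul1r H2mulDl H2mulDr H2one_neq0.

Lemma H2scaleAl (c : k) h g : c *: (h * g) = (c *: h) * g.
Proof. by apply: H2P => i; rewrite !(hcoordM, hcoordZ) /=; ring. Qed.

Lemma H2scaleAr (c : k) h g : c *: (h * g) = h * (c *: g).
Proof. by apply: H2P => i; rewrite !(hcoordM, hcoordZ) /=; ring. Qed.

HB.instance Definition _ := GRing.Lmodule_isLalgebra.Build k (H2 k) H2scaleAl.
HB.instance Definition _ := GRing.Lalgebra_isAlgebra.Build k (H2 k) H2scaleAr.

Definition H2x : H2 k := H2basis true.

Lemma H2xx : H2x * H2x = 1.
Proof.
by apply: H2P; case; rewrite hcoordM !hcoord_basis /=; ring.
Qed.

End H2Algebra.

Arguments H2basis {k}.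
Arguments H2x {k}.

(* The tensor product V (x) H(2), realized on the basis {1, x} as V (+) V: the
   element t is t false (x) 1 + t true (x) x.  Iterated, V (x) H(2) (x) H(2) is
   tensH (tensH V), and H(2) (x) H(2) is tensH (H2 k). *)
Notation tensH V := {ffun bool -> V}.

Section Tensor.
Variables (k : fieldType) (V W : lmodType k).

Definition tens (v : V) (h : H2 k) : tensH V := [ffun i => hcoord h i *: v].

(* For f bilinear, the image of t under the linear map V (x) H(2) -> W induced
   by f: in Sweedler's notation t = v (x) h, this is f(v, h). *)
Definition sweedler (t : tensH V) (f : V -> H2 k -> W) : W :=
  \sum_(i : bool) f (t i) (H2basis i).

(* The linear map H(2) -> V sending 1 to v false and x to v true. *)
Definition linext (v : bool -> V) (h : H2 k) : V := \sum_(i : bool) hcoord h i *: v i.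

Lemma linext_linear v : linear (linext v).
Proof.
move=> c h g; rewrite /linext scaler_sumr -big_split; apply: eq_bigr => i _.
by rewrite hcoordD hcoordZ scalerDl scalerA.
Qed.

HB.instance Definition _ v :=
  GRing.isLinear.Build k (H2 k) V *:%R (linext v) (linext_linear v).

End Tensor.

Notation "v \ox h" := (tens v h) : ring_scope.

Section TensorTheory.
Variable k : fieldType.

Lemma linext_basis (V : lmodType k) (v : bool -> V) i : linext v (H2basis i) = v i.
Proof.
rewrite /linext (bigD1 i) //= big1 ?addr0 ?hcoord_basis ?eqxx ?scale1r //.
by move=> j ne; rewrite hcoord_basis eq_sym (negPf ne) scale0r.
Qed.

Lemma H2_sum (h : H2 k) : h = \sum_(i : bool) hcoord h i *: H2basis i.
Proof.
apply: H2P => i.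
by rewrite big_bool hcoordD !hcoordZ !hcoord_basis; case: i => /=; ring.
Qed.

Lemma sweedler_tens (V W : lmodType k) (f : {bilinear V -> H2 k -> W}) v h :
  sweedler (v \ox h) f = f v h.
Proof.
rewrite /sweedler [in RHS](H2_sum h) linear_sumr; apply: eq_bigr => i _.
by rewrite ffunE linearZl_LR linearZr_LR.
Qed.

Lemma sweedler_linear (V W : lmodType k) (f : {bilinear V -> H2 k -> W}) :
  linear (fun t : tensH V => sweedler t f).
Proof.
move=> c t u; rewrite /sweedler scaler_sumr -big_split; apply: eq_bigr => i _ /=.
by rewrite !ffunE linearDl linearZl_LR.
Qed.

End TensorTheory.

Section CoquasiHopf.
Variable k : fieldType.
Implicit Types h g l : H2 k.

Definition comul : H2 k -> tensH (H2 k) :=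
  linext (fun i => H2basis i \ox H2basis i).

Definition counit h : k := \sum_(i : bool) hcoord h i.

Definition sw2 (W : lmodType k) h (f : H2 k -> H2 k -> W) : W :=
  sweedler (comul h) f.

Definition sw3 (W : lmodType k) h (f : H2 k -> H2 k -> H2 k -> W) : W :=
  sw2 h (fun h' h3 => sw2 h' (fun h1 h2 => f h1 h2 h3)).

Definition omega h g l : k :=
  \sum_(i : bool) \sum_(j : bool) \sum_(m : bool)
    hcoord h i * hcoord g j * hcoord l m * (-1) ^+ [&& i, j & m].

Definition antipode h : H2 k := h.

Definition alpha h : k := \sum_(i : bool) hcoord h i * (-1) ^+ i.

Definition beta h : k := \sum_(i : bool) hcoord h i.

End CoquasiHopf.

(* The multiplication of A is not assumed associative, hence no ring structure
   on A. *)
Record comodAlg (k : fieldType) := ComodAlg {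
  ca_sort :> lmodType k;
  ca_mul : {bilinear ca_sort -> ca_sort -> ca_sort};
  ca_one : ca_sort;
  ca_rho : {linear ca_sort -> tensH ca_sort};
  ca_coassoc : forall a : ca_sort,
    sweedler (ca_rho a) (fun a0 a1 => ca_rho a0 \ox a1) =
    sweedler (ca_rho a) (fun a0 a1 => sw2 a1 (fun h1 h2 => a0 \ox h1 \ox h2));
  ca_counit : forall a : ca_sort,
    sweedler (ca_rho a) (fun a0 a1 => counit a1 *: a0) = a;
  ca_rhoM : forall a b : ca_sort,
    ca_rho (ca_mul a b) =
    sweedler (ca_rho a) (fun a0 a1 => sweedler (ca_rho b) (fun b0 b1 =>
      ca_mul a0 b0 \ox (a1 * b1)));
  ca_rho1 : ca_rho ca_one = ca_one \ox 1;
  ca_mul1l : left_id ca_one ca_mul;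
  ca_mul1r : right_id ca_one ca_mul;
  ca_assoc : forall a b c : ca_sort,
    ca_mul (ca_mul a b) c =
    sweedler (ca_rho a) (fun a0 a1 => sweedler (ca_rho b) (fun b0 b1 =>
      sweedler (ca_rho c) (fun c0 c1 =>
        omega a1 b1 c1 *: ca_mul a0 (ca_mul b0 c0))))
}.

Notation "a ** b" := (ca_mul _ a b) : ring_scope.
Notation rho := (ca_rho _).

Section Coinvariants.
Variables (k : fieldType) (A : comodAlg k).
Implicit Types a b c : A.

Definition coinvariant : {pred A} := [pred a | rho a == a \ox 1].

Record coinv := Coinv { coinv_val :> A; _ : coinv_val \in coinvariant }.

HB.instance Definition _ := [isSub for coinv_val].
HB.instance Definition _ := [Choice of coinv by <:].

Lemma rho_coinv (r : coinv) : rho (val r) = val r \ox 1.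
Proof. by case: r => r /= /eqP. Qed.

Lemma tens1E (V : lmodType k) (v : V) i : (v \ox 1) i = (~~ i)%:R *: v.
Proof. by rewrite ffunE hcoord_basis; case: i. Qed.

Lemma coinvariant_submod : submod_closed coinvariant.
Proof.
split; first by apply/eqP/ffunP=> i; rewrite linear0 tens1E scaler0 ffunE.
move=> c a b /eqP ra /eqP rb; apply/eqP/ffunP=> i.
by rewrite linearP ra rb !ffunE !scalerDr !scalerA mulrC.
Qed.

HB.instance Definition _ :=
  GRing.isSubmodClosed.Build k A coinvariant coinvariant_submod.
HB.instance Definition _ := [SubChoice_isSubLmodule of coinv by <:].

Lemma sweedler1 (W : lmodType k) (a : A) (f : A -> H2 k -> W) :
  f 0 H2x = 0 -> sweedler (a \ox 1) f = f a 1.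
Proof.
by move=> f0; rewrite /sweedler big_bool !tens1E /= mulr0n mulr1n scale0r scale1r f0 add0r.
Qed.

Lemma one_coinvariant : ca_one A \in coinvariant.
Proof. by apply/eqP; exact: ca_rho1. Qed.

Lemma mul_coinvariant (r s : coinv) : val r ** val s \in coinvariant.
Proof.
have tens0 h : (0 : A) \ox h = 0 by apply/ffunP=> i; rewrite !ffunE scaler0.
by apply/eqP; rewrite ca_rhoM !rho_coinv !sweedler1 ?linear0l ?linear0r ?tens0 ?mulr1.
Qed.

Lemma omega11 (h : H2 k) : omega 1 1 h = counit h.
Proof. by rewrite /omega /counit !big_bool !hcoord_basis /=; ring. Qed.

Lemma coinv_assoc (r s : coinv) a : (val r ** val s) ** a = val r ** (val s ** a).
Proof.
have z (t : tensH A) (w : H2 k -> k) b :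
    sweedler t (fun y0 y1 => w y1 *: ((0 : A) ** (b ** y0))) = 0.
  by rewrite /sweedler big1 // => i _; rewrite linear0l scaler0.
have z' (t : tensH A) (w : H2 k -> k) b :
    sweedler t (fun y0 y1 => w y1 *: (b ** ((0 : A) ** y0))) = 0.
  by rewrite /sweedler big1 // => i _; rewrite linear0l linear0r scaler0.
rewrite ca_assoc !rho_coinv !sweedler1 ?z ?z' //.
under [LHS]eq_bigr => i _ do rewrite omega11 -2!linearZr_LR.
by rewrite -2!linear_sumr [\sum_(i : bool) _]ca_counit.
Qed.

(* B = A^{co H(2)} is an associative unital k-algebra.  It is only declared as a
   ring and a k-module because algType excludes the zero ring. *)
Definition coinv_one : coinv := Coinv one_coinvariant.
Definition coinv_mul (r s : coinv) : coinv := Coinv (mul_coinvariant r s).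

Fact coinv_mulA : associative coinv_mul.
Proof. by move=> r s t; apply: val_inj; rewrite /= coinv_assoc. Qed.
Fact coinv_mul1l : left_id coinv_one coinv_mul.
Proof. by move=> r; apply: val_inj; exact: ca_mul1l. Qed.
Fact coinv_mul1r : right_id coinv_one coinv_mul.
Proof. by move=> r; apply: val_inj; exact: ca_mul1r. Qed.
Fact coinv_mulDl : left_distributive coinv_mul +%R.
Proof. by move=> r s t; apply: val_inj; exact: linearDl. Qed.
Fact coinv_mulDr : right_distributive coinv_mul +%R.
Proof. by move=> r s t; apply: val_inj; exact: linearDr. Qed.

HB.instance Definition _ := GRing.Zmodule_isPzRing.Build coinv
  coinv_mulA coinv_mul1l coinv_mul1r coinv_mulDl coinv_mulDr.

Fact coinv_scaleAl (x : k) (r s : coinv) : x *: (r * s) = (x *: r) * s.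
Proof. by apply: val_inj; rewrite /= linearZl_LR. Qed.
Fact coinv_scaleAr (x : k) (r s : coinv) : x *: (r * s) = r * (x *: s).
Proof. by apply: val_inj; rewrite /= linearZr_LR. Qed.

(* A as a left B-module. *)
Definition coinv_module : Type := A.
HB.instance Definition _ := GRing.Zmodule.copy coinv_module A.

Definition coinv_act (r : coinv) (a : coinv_module) : coinv_module := val r ** (a : A).

Fact coinv_actA r s a : coinv_act r (coinv_act s a) = coinv_act (r * s) a.
Proof. by rewrite /coinv_act -coinv_assoc. Qed.
Fact coinv_act1 : left_id 1 coinv_act.
Proof. by move=> a; exact: ca_mul1l. Qed.
Fact coinv_actDr : right_distributive coinv_act +%R.
Proof. by move=> r a b; exact: linearDr. Qed.
Fact coinv_actDl a : {morph coinv_act^~ a : r s / r + s}.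
Proof. by move=> r s; exact: linearDl. Qed.

HB.instance Definition _ := GRing.Zmodule_isLmodule.Build coinv coinv_module
  coinv_actA coinv_act1 coinv_actDr coinv_actDl.

End Coinvariants.

Arguments coinv {k} A.
Arguments coinv_module {k} A.

(* M is free with basis the family v. *)
Definition module_basis (R : pzRingType) (M : lmodType R) (I : finType)
    (v : I -> M) : Prop :=
  forall y : M, exists! r : {ffun I -> R}, y = \sum_(i : I) r i *: v i.

Section Cleft.
Variables (k : fieldType) (A : comodAlg k).

Definition cleaving_system (gamma delta : {linear H2 k -> A}) : Prop :=
  [/\ forall h, rho (gamma h) = sw2 h (fun h1 h2 => gamma h1 \ox h2),
      forall h, rho (delta h) = sw2 h (fun h1 h2 => delta h2 \ox antipode h1),
      forall h, sw2 h (fun h1 h2 => delta h1 ** gamma h2) = alpha h *: ca_one A &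
      forall h, sw3 h (fun h1 h2 h3 => beta h2 *: (gamma h1 ** delta h3))
                = counit h *: ca_one A].

Definition cleft : Prop :=
  exists gamma delta : {linear H2 k -> A}, cleaving_system gamma delta.

(* The product of the crossed product of B = A^{co H(2)} and H(2) on
   B (x) H(2), for a weak action wa and a cocycle sg. *)
Definition crossed_mul (wa : {bilinear H2 k -> coinv A -> coinv A})
    (sg : {bilinear H2 k -> H2 k -> coinv A}) (t u : tensH (coinv A)) :
    tensH (coinv A) :=
  sweedler t (fun r h => sweedler u (fun s g =>
    sw3 h (fun h1 h2 h3 => sw2 g (fun g1 g2 =>
      (r * wa h1 s * sg h2 g1) \ox (h3 * g2))))).

Definition nu (gamma : {linear H2 k -> A}) (t : tensH (coinv A)) : A :=
  sweedler t (fun r h => val r ** gamma h).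

(* wa and sg are the weak action and the cocycle of the crossed product
   structure attached to (gamma, delta).  In the product of gamma h1, r and
   delta h3 the parentheses are immaterial since r is coinvariant. *)
Definition crossed_structure (gamma delta : {linear H2 k -> A})
    (wa : {bilinear H2 k -> coinv A -> coinv A})
    (sg : {bilinear H2 k -> H2 k -> coinv A}) : Prop :=
  [/\ forall h r, val (wa h r) =
        sw3 h (fun h1 h2 h3 => beta h2 *: ((gamma h1 ** val r) ** delta h3)),
      forall h g, val (sg h g) =
        sw3 h (fun h1 h2 h3 => sw3 g (fun g1 g2 g3 =>
          beta (h2 * g2) *: ((gamma h1 ** gamma g1) ** delta (h3 * g3)))) &
      [/\ linear (nu gamma), bijective (nu gamma), nu gamma ((1 : coinv A) \ox 1) = ca_one A &
          forall t u, nu gamma (crossed_mul wa sg t u) = nu gamma t ** nu gamma u]].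

Definition cleft_pair (a b : A) : Prop :=
  [/\ a ** b = ca_one A, b ** a = - ca_one A, rho a = a \ox H2x & rho b = b \ox H2x].

Definition unital_map (a : A) : {linear H2 k -> A} :=
  linext (fun i : bool => if i then a else ca_one A).

End Cleft.

(* Main.v *)
Require Import Defs.
From HB Require Import structures.
From mathcomp Require Import all_boot all_order all_algebra.

Set Implicit Arguments.
Unset Strict Implicit.
Unset Printing Implicit Defensive.

Import GRing.Theory.
Local Open Scope ring_scope.

(** A right comodule over H(2) = k[C_2] is a Z/2-graded space: the components of
    rho on the basis {1, x} are the two homogeneous projections.  Evaluating
    omega on the basis, a comodule algebra is therefore a unital graded algebra
    in which
      (ab)c = (-1)^(|a||b||c|) a(bc)
    for homogeneous a, b, c (homog_assoc); its even part is B.  Every Sweedler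
    formula is linear in its arguments in H(2), so it can be tested on the
    grouplikes 1 and x, where it becomes an identity between homogeneous
    elements.

    For a cleaving system this test (cleaving_systemP) says that gamma(1) and
    delta(1) are mutually inverse even elements, and that gamma(x), delta(x) are
    odd with gamma(x)delta(x) = 1 and delta(x)gamma(x) = alpha(x) = -1.  Hence
    (gamma(x), delta(x)) is a pair (a, b) as required, and conversely such a
    pair yields a cleaving system once 1 is sent to 1.

    Given (a, b), the sign ba = -1 exactly compensates the sign of associativity
    on three odd elements: (yb)a = -y(ba) = y for y odd, while (ya)b = y for y
    even.  So right multiplication by b is the inverse of right multiplication
    by a from the even to the odd part, and A is the direct sum of B and Ba,
    which is both the freeness of A over B and the bijectivity of nu.  The same
    compensation gives b(aa) = a and a(bb) = -b, from which follow the
    invertibility of a^2 and, case by case on degrees, the multiplicativity of nu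
    on the crossed product. *)

(** * Sweedler sums on grouplikes *)

Section SweedlerCalculus.
Variables (k : fieldType) (V W : lmodType k).

(** The component of v (x) x^i on the other grouplike is zero; the functions f
    in use are nested Sweedler sums, for which vanishing at 0 is quickly seen. *)
Lemma sweedler_tens_basis (v : V) i (f : V -> H2 k -> W) :
  (forall h, f 0 h = 0) -> sweedler (v \ox H2basis i) f = f v (H2basis i).
Proof.
move=> f0; rewrite /sweedler big_bool !ffunE !hcoord_basis.
by case: i; rewrite /= !scale0r !scale1r !f0 ?addr0 ?add0r.
Qed.

Lemma sweedler0 (t : tensH V) (f : V -> H2 k -> W) :
  (forall v h, f v h = 0) -> sweedler t f = 0.
Proof. by move=> f0; rewrite /sweedler big1. Qed.

Lemma comulE (h : H2 k) i : comul h i = hcoord h i *: H2basis i.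
Proof.
rewrite /comul /linext big_bool !ffunE !hcoord_basis.
by case: i; rewrite /= !scale0r !scale1r !scaler0 ?addr0 ?add0r.
Qed.

(** The components of the coproduct of h are multiples of grouplikes, so
    homogeneity of f in its first argument is enough to linearize.  This can
    be checked under nested sums. *)
Lemma sw2E (h : H2 k) (f : H2 k -> H2 k -> W) :
    (forall c h1 h2, f (c *: h1) h2 = c *: f h1 h2) ->
  sw2 h f = \sum_(i : bool) hcoord h i *: f (H2basis i) (H2basis i).
Proof.
move=> fZ; apply: eq_bigr => i _; rewrite -fZ; congr (f _ _).
by exact: comulE.
Qed.

Lemma sw3E (h : H2 k) (f : H2 k -> H2 k -> H2 k -> W) :
    (forall c h1 h2 h3, f (c *: h1) h2 h3 = c *: f h1 h2 h3) ->
  sw3 h f = \sum_(i : bool) hcoord h i *: f (H2basis i) (H2basis i) (H2basis i).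
Proof.
move=> fZ; rewrite /sw3 sw2E => [|c h1 h2].
  apply: eq_bigr => i _; congr (_ *: _); rewrite sw2E // big_bool !hcoord_basis.
  by case: i; rewrite /= scale0r scale1r ?addr0 ?add0r.
rewrite !sw2E // scaler_sumr; apply: eq_bigr => i _.
by rewrite hcoordZ scalerA.
Qed.

End SweedlerCalculus.

Section Extension.
Variable k : fieldType.

Lemma linextE (V : lmodType k) (v : bool -> V) h :
  linext v h = hcoord h true *: v true + hcoord h false *: v false.
Proof. by rewrite /linext big_bool. Qed.

Lemma sum_basis (V : lmodType k) i (f : bool -> V) :
  \sum_j hcoord (H2basis i : H2 k) j *: f j = f i.
Proof. exact: linext_basis. Qed.

Variables V W : lmodType k.

Definition bilinext (w : bool -> {linear V -> W}) (h : H2 k) (v : V) : W :=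
  linext (fun i => w i v) h.

Fact bilinext_bilinear w : bilinear_for *:%R *:%R (bilinext w).
Proof.
split=> [v c h g|h c v v']; first exact: linearP.
rewrite /bilinext /= !linextE !(linearP (w _)) !scalerDr !scalerA.
by rewrite ![_ * c]mulrC -!scalerA addrACA -!scalerDr.
Qed.

HB.instance Definition _ w :=
  bilinear_isBilinear.Build k (H2 k) V W _ _ (bilinext w) (bilinext_bilinear w).

End Extension.

(** * The structure of H(2) on its basis *)

Section FormsOnBasis.
Variable k : fieldType.

Lemma H2basisM i j : H2basis i * H2basis j = H2basis (i (+) j) :> H2 k.
Proof.
apply: H2P => m; rewrite hcoordM !hcoord_basis.
by case: i j m => [] [] [] /=; rewrite ?(mul0r, mulr0, mulr1, addr0, add0r).
Qed.

Lemma omega_basis i j m :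
  omega (H2basis i) (H2basis j) (H2basis m) = (-1) ^+ [&& i, j & m] :> k.
Proof.
rewrite /omega !big_bool !hcoord_basis.
by case: i j m => [] [] []; rewrite /= ?(mul0r, mulr0, mul1r, addr0, add0r).
Qed.

Lemma alpha_basis i : alpha (H2basis i) = (-1) ^+ i :> k.
Proof.
by rewrite /alpha big_bool !hcoord_basis; case: i;
  rewrite /= ?(mul0r, mul1r, addr0, add0r).
Qed.

Lemma beta_basis i : beta (H2basis i) = 1 :> k.
Proof.
by rewrite /beta big_bool !hcoord_basis; case: i; rewrite /= ?(addr0, add0r).
Qed.

Lemma counit_basis i : counit (H2basis i) = 1 :> k.
Proof. exact: beta_basis. Qed.

End FormsOnBasis.

(** * The grading of a comodule algebra *)

Section Grading.
Variables (k : fieldType) (A : comodAlg k).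
Implicit Types (a b c y : A) (r s : coinv A).

Definition homog (i : bool) (a : A) : Prop := rho a = a \ox H2basis i.

Lemma tens0l h : (0 : A) \ox h = 0.
Proof. by apply/ffunP=> i; rewrite !ffunE scaler0. Qed.

Lemma homogM i j a b : homog i a -> homog j b -> homog (i (+) j) (a ** b).
Proof.
move=> ha hb; rewrite /homog ca_rhoM ha hb sweedler_tens_basis => [|h].
  by rewrite sweedler_tens_basis ?H2basisM // => h; rewrite linear0r tens0l.
by apply: sweedler0 => v g; rewrite linear0l tens0l.
Qed.

(** The reassociator is -1 on (x, x, x) only, so associativity holds up to a
    sign that appears for three odd factors. *)
Lemma homog_assoc i j m a b c : homog i a -> homog j b -> homog m c ->
  (a ** b) ** c = (-1) ^+ [&& i, j & m] *: (a ** (b ** c)).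
Proof.
move=> ha hb hc; rewrite ca_assoc ha hb hc.
rewrite !sweedler_tens_basis ?omega_basis //.
- by move=> h; rewrite !linear0r scaler0.
- by move=> h; apply: sweedler0 => v g; rewrite linear0l linear0r scaler0.
move=> h; apply: sweedler0 => v g; apply: sweedler0 => w l.
by rewrite linear0l scaler0.
Qed.

Lemma homog1 : homog false (ca_one A).
Proof. exact: ca_rho1. Qed.

Lemma homog_coinv r : homog false (val r).
Proof. exact: rho_coinv. Qed.

Lemma coinvariantP a : reflect (homog false a) (a \in @coinvariant k A).
Proof. exact: eqP. Qed.

(** Coassociativity, read on coordinates: the projections onto the components of
    rho are orthogonal idempotents. *)
Lemma homog_rho i a : homog i (rho a i).
Proof.
have /ffunP/(_ i)/ffunP e := ca_coassoc a.
apply/ffunP => j; move: (e j); rewrite /sweedler !sum_ffunE !big_bool /=.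
rewrite !ffunE /= !hcoord_basis.
rewrite /sw2 /sweedler !big_bool /= !ffunE !comulE !hcoordZ !hcoord_basis.
by case: i j {e} => [] []; rewrite /= ?(mulr0, mulr1, scale0r, scale1r, addr0, add0r).
Qed.

(** The counit axiom makes the two projections sum to the identity. *)
Lemma rho_sum a : (rho a true : A) + rho a false = a.
Proof.
by rewrite -[RHS]ca_counit /sweedler big_bool !counit_basis !scale1r.
Qed.

Lemma rhoE i a : homog i a -> forall j, rho a j = (i == j)%:R *: a.
Proof. by move=> -> j; rewrite ffunE hcoord_basis. Qed.

Lemma mulA_even i j m a b c : homog i a -> homog j b -> homog m c ->
  [&& i, j & m] = false -> (a ** b) ** c = a ** (b ** c).
Proof. by move=> ha hb hc e; rewrite (homog_assoc ha hb hc) e scale1r. Qed.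

Lemma mulA_odd a b c : homog true a -> homog true b -> homog true c ->
  (a ** b) ** c = - (a ** (b ** c)).
Proof. by move=> ha hb hc; rewrite (homog_assoc ha hb hc) scaleN1r. Qed.

End Grading.

(** * The product of the crossed product on basis tensors *)

Section CrossedProduct.
Variables (k : fieldType) (A : comodAlg k) (gamma : {linear H2 k -> A}).
Variables (wa : {bilinear H2 k -> coinv A -> coinv A}).
Variables (sg : {bilinear H2 k -> H2 k -> coinv A}).
Implicit Types (r s : coinv A) (t u : tensH (coinv A)).

Lemma nu_linear : linear (nu gamma).
Proof.
move=> c t u; rewrite /nu /sweedler scaler_sumr -big_split.
by apply: eq_bigr => i _; rewrite !ffunE /= linearPl.
Qed.

HB.instance Definition _ :=
  GRing.isLinear.Build k (tensH (coinv A)) A *:%R (nu gamma) nu_linear.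

Lemma nu_tens_basis r i : nu gamma (r \ox H2basis i) = val r ** gamma (H2basis i).
Proof. by rewrite /nu sweedler_tens_basis // => h; rewrite linear0l. Qed.

Lemma tensZ (V : lmodType k) c (v : V) h : (c *: v) \ox h = c *: (v \ox h).
Proof. by apply/ffunP=> i; rewrite !ffunE !scalerA mulrC. Qed.

Lemma crossed_mulE t u : crossed_mul wa sg t u =
  \sum_i \sum_j (t i * wa (H2basis i) (u j) * sg (H2basis i) (H2basis j))
                 \ox H2basis (i (+) j).
Proof.
apply: eq_bigr => i _; apply: eq_bigr => j _.
rewrite sw3E => [|c h1 h2 h3]; last first.
  rewrite !sw2E ?scaler_sumr => [||]; last 2 first.
  - by move=> d g1 g2; rewrite linearZr_LR -coinv_scaleAr tensZ.
  - by move=> d g1 g2; rewrite linearZr_LR -coinv_scaleAr tensZ.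
  apply: eq_bigr => m _.
  by rewrite linearZl_LR -coinv_scaleAr -coinv_scaleAl tensZ !scalerA mulrC.
rewrite sum_basis sw2E ?sum_basis ?H2basisM // => c h1 h2.
by rewrite linearZr_LR -coinv_scaleAr tensZ.
Qed.

(** Multiplicativity of nu reduces to one identity for each pair of degrees,
    since both sides are biadditive. *)
Lemma nu_crossed_mul :
    (forall i j r s,
       val (r * wa (H2basis i) s * sg (H2basis i) (H2basis j))
         ** gamma (H2basis (i (+) j)) =
       (val r ** gamma (H2basis i)) ** (val s ** gamma (H2basis j))) ->
  forall t u, nu gamma (crossed_mul wa sg t u) = nu gamma t ** nu gamma u.
Proof.
move=> nuM t u; rewrite crossed_mulE linear_sum linear_sumlz.
apply: eq_bigr => i _; rewrite linear_sum linear_sumr.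
by apply: eq_bigr => j _ /=; rewrite nu_tens_basis nuM.
Qed.

End CrossedProduct.

(** * Cleaving systems on grouplikes *)

Section CleavingSystems.
Variables (k : fieldType) (A : comodAlg k).

(** Both sides of each axiom are linear in h, and on a grouplike g the axioms
    are conditions on gamma(g) and delta(g) alone: the antipode is the identity,
    and alpha(x) = -1 is where the sign comes from. *)
Lemma cleaving_systemP (gamma delta : {linear H2 k -> A}) :
  cleaving_system gamma delta <-> forall i,
    [/\ homog i (gamma (H2basis i)), homog i (delta (H2basis i)),
        delta (H2basis i) ** gamma (H2basis i) = (-1) ^+ i *: ca_one A &
        gamma (H2basis i) ** delta (H2basis i) = ca_one A].
Proof.
have rhoG (f : {linear H2 k -> A}) h :
    sw2 h (fun h1 h2 => f h1 \ox h2) =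
    \sum_i hcoord h i *: (f (H2basis i) \ox H2basis i).
  by rewrite sw2E // => c h1 h2; rewrite linearZ tensZ.
have rhoD (f : {linear H2 k -> A}) h :
    sw2 h (fun h1 h2 => f h2 \ox antipode h1) =
    \sum_i hcoord h i *: (f (H2basis i) \ox H2basis i).
  (* Here the first leg of the coproduct is the right factor of the tensor. *)
  rewrite sw2E // => c h1 h2; apply/ffunP => i.
  by rewrite !ffunE /antipode hcoordZ scalerA.
have convDG h :
    sw2 h (fun h1 h2 => delta h1 ** gamma h2) =
    \sum_i hcoord h i *: (delta (H2basis i) ** gamma (H2basis i)).
  by rewrite sw2E // => c h1 h2; rewrite linearZ linearZl_LR.
have convGD h :
    sw3 h (fun h1 h2 h3 => beta h2 *: (gamma h1 ** delta h3)) =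
    \sum_i hcoord h i *: (gamma (H2basis i) ** delta (H2basis i)).
  rewrite sw3E => [|c h1 h2 h3].
    by apply: eq_bigr => i _; rewrite beta_basis scale1r.
  by rewrite linearZ linearZl_LR /= !scalerA mulrC.
split=> [[Hg Hd Hdg Hgd] i|H].
  split.
  - by rewrite /homog Hg rhoG sum_basis.
  - by rewrite /homog Hd rhoD sum_basis.
  - by have := Hdg (H2basis i); rewrite convDG sum_basis alpha_basis.
  - by have := Hgd (H2basis i); rewrite convGD sum_basis counit_basis scale1r.
split=> h; rewrite ?(rhoG, rhoD, convDG, convGD).
- rewrite {1}[h]H2_sum !linear_sum; apply: eq_bigr => i _.
  by rewrite !linearZ; case: (H i) => ->.
- rewrite {1}[h]H2_sum !linear_sum; apply: eq_bigr => i _.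
  by rewrite !linearZ; case: (H i) => _ ->.
- rewrite /alpha scaler_suml; apply: eq_bigr => i _.
  by rewrite -scalerA; case: (H i) => _ _ ->.
- rewrite /counit scaler_suml; apply: eq_bigr => i _.
  by case: (H i) => _ _ _ ->.
Qed.

Lemma weak_action_sw3E (gamma delta : {linear H2 k -> A}) h (y : A) :
  sw3 h (fun h1 h2 h3 => beta h2 *: ((gamma h1 ** y) ** delta h3)) =
  \sum_i hcoord h i *: ((gamma (H2basis i) ** y) ** delta (H2basis i)).
Proof.
rewrite sw3E => [|c h1 h2 h3].
  by apply: eq_bigr => i _; rewrite beta_basis scale1r.
rewrite [gamma (_ *: _)]linearZ_LR 2!linearZl_LR !scalerA.
by rewrite [_ * c]mulrC.
Qed.

Lemma cocycle_sw3E (gamma delta : {linear H2 k -> A}) h g :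
  sw3 h (fun h1 h2 h3 => sw3 g (fun g1 g2 g3 =>
    beta (h2 * g2) *: ((gamma h1 ** gamma g1) ** delta (h3 * g3)))) =
  \sum_i hcoord h i *: \sum_j hcoord g j *:
    ((gamma (H2basis i) ** gamma (H2basis j)) ** delta (H2basis (i (+) j))).
Proof.
have inner h1 h2 h3 : sw3 g (fun g1 g2 g3 =>
      beta (h2 * g2) *: ((gamma h1 ** gamma g1) ** delta (h3 * g3))) =
    \sum_j hcoord g j *: (beta (h2 * H2basis j) *:
      ((gamma h1 ** gamma (H2basis j)) ** delta (h3 * H2basis j))).
  rewrite sw3E // => c g1 g2 g3.
  rewrite [gamma (_ *: _)]linearZ_LR linearZr_LR linearZl_LR !scalerA.
  by rewrite [_ * c]mulrC.
rewrite sw3E => [|c h1 h2 h3]; last first.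
  rewrite !inner scaler_sumr; apply: eq_bigr => j _.
  rewrite [gamma (_ *: _)]linearZ_LR 2!linearZl_LR !scalerA.
  by rewrite [_ * _ * c]mulrC mulrA.
apply: eq_bigr => i _; rewrite inner; congr (_ *: _).
by apply: eq_bigr => j _; rewrite !H2basisM beta_basis scale1r.
Qed.

End CleavingSystems.

(** * Consequences of a pair (a, b) *)

Section CleftPair.
Variables (k : fieldType) (A : comodAlg k) (a b : A).
Hypothesis ab : cleft_pair a b.
Implicit Types (y : A) (r s : coinv A) (t : tensH (coinv A)).

Lemma cleft_pair_homogl : homog true a. Proof. by case: ab. Qed.
Lemma cleft_pair_homogr : homog true b. Proof. by case: ab. Qed.
Lemma cleft_pairV : a ** b = ca_one A. Proof. by case: ab. Qed.
Lemma cleft_pairVN : b ** a = - ca_one A. Proof. by case: ab. Qed.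

Let ha := cleft_pair_homogl.
Let hb := cleft_pair_homogr.
Let hr := @homog_coinv k A.

Lemma mul_even_a_b y : homog false y -> (y ** a) ** b = y.
Proof.
by move=> hy; rewrite (mulA_even hy ha hb) // cleft_pairV ca_mul1r.
Qed.

(** The signs of associativity and of ba = -1 cancel. *)
Lemma mul_odd_b_a y : homog true y -> (y ** b) ** a = y.
Proof.
by move=> hy; rewrite (mulA_odd hy hb ha) cleft_pairVN linearNr opprK ca_mul1r.
Qed.

Lemma mul_b_aa : b ** (a ** a) = a.
Proof.
apply: oppr_inj; rewrite -(mulA_odd hb ha ha) cleft_pairVN linearNl.
by rewrite ca_mul1l.
Qed.

Lemma mul_a_bb : a ** (b ** b) = - b.
Proof.
by apply: oppr_inj; rewrite -(mulA_odd ha hb hb) cleft_pairV ca_mul1l opprK.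
Qed.

Definition even_part y : coinv A := Coinv (introT (coinvariantP _) (homog_rho false y)).

Lemma odd_mul_coinvariant y z :
  homog true y -> homog true z -> y ** z \in @coinvariant k A.
Proof. by move=> hy hz; apply/coinvariantP; exact: (homogM hy hz). Qed.

(** The coefficient of a in y: the odd part y_1 of y is (y_1 b) a. *)
Definition odd_coord y : coinv A :=
  Coinv (odd_mul_coinvariant (homog_rho true y) hb).

Lemma homog_mul_a r : homog true (val r ** a).
Proof. exact: (homogM (hr r) ha). Qed.

Lemma homog_a_mul r : homog true (a ** val r).
Proof. exact: (homogM ha (hr r)). Qed.

Lemma unital_map_basis (c : A) (i : bool) :
  unital_map c (H2basis i) = if i then c else ca_one A.
Proof. exact: linext_basis. Qed.

Lemma nu_unital t :
  nu (unital_map a) t = val (t true) ** a + val (t false).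
Proof. by rewrite /nu /sweedler big_bool !unital_map_basis ca_mul1r. Qed.

Definition nu_inv y : tensH (coinv A) :=
  [ffun i : bool => if i then odd_coord y else even_part y].

Lemma nu_invK : cancel nu_inv (nu (unital_map a)).
Proof.
move=> y; rewrite nu_unital !ffunE /= mul_odd_b_a ?rho_sum //.
exact: homog_rho.
Qed.

Lemma nuK : cancel (nu (unital_map a)) nu_inv.
Proof.
move=> t; apply/ffunP => i; apply: val_inj; rewrite ffunE nu_unital.
have rhoS j : rho (val (t true) ** a + val (t false)) j =
    j%:R *: (val (t true) ** a) + (~~ j)%:R *: val (t false) :> A.
  rewrite linearD ffunE (rhoE (homog_mul_a _)) (rhoE (hr _)).
  by case: j.
case: i; rewrite /= rhoS /= scale1r scale0r ?addr0 ?add0r //.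
by rewrite mul_even_a_b; last exact: hr.
Qed.

Lemma cleft_pair_cleaving : cleaving_system (unital_map a) (unital_map b).
Proof.
apply/cleaving_systemP => i; rewrite !unital_map_basis.
case: i; split; rewrite ?scale1r ?scaleN1r ?ca_mul1l //;
  [exact: cleft_pairVN | exact: cleft_pairV | exact: homog1 | exact: homog1].
Qed.

(** The map nu of (unital_map a) sends a pair of coefficients to the linear
    combination of a and 1 that they define, so its bijectivity is freeness. *)
Lemma cleft_pair_basis :
  module_basis (M := coinv_module A) (fun i : bool => if i then a else ca_one A).
Proof.
pose v (i : bool) : coinv_module A := if i then a else ca_one A.
have nuS (t : tensH (coinv A)) : nu (unital_map a) t =
    \sum_(i : bool) t i *: v i :> coinv_module A.
  by apply: eq_bigr => i _; rewrite unital_map_basis.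
move=> y; exists (nu_inv y); split=> [|t yE].
  by rewrite -[LHS]nu_invK; exact: nuS.
by have -> : y = nu (unital_map a) t; [exact: etrans yE (esym (nuS t)) | exact: nuK].
Qed.

Definition square_a : coinv A := Coinv (odd_mul_coinvariant ha ha).
Definition neg_square_b : coinv A := - Coinv (odd_mul_coinvariant hb hb).

Lemma square_aV : square_a * neg_square_b = 1.
Proof.
rewrite mulrN; apply: val_inj; rewrite /=.
have hbb : homog false (b ** b) by exact: (homogM hb hb).
by rewrite (mulA_even ha ha hbb) // mul_a_bb linearNr cleft_pairV opprK.
Qed.

Lemma square_aVl : neg_square_b * square_a = 1.
Proof.
rewrite mulNr; apply: val_inj; rewrite /=.
have haa : homog false (a ** a) by exact: (homogM ha ha).
by rewrite (mulA_even hb hb haa) // mul_b_aa cleft_pairVN opprK.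
Qed.

Definition conj_a r : coinv A :=
  Coinv (odd_mul_coinvariant (homog_a_mul r) hb).

Fact conj_a_linear : linear conj_a.
Proof. by move=> c r s; apply: val_inj; rewrite /= linearPr linearPl. Qed.

HB.instance Definition _ :=
  GRing.isLinear.Build k (coinv A) (coinv A) *:%R conj_a conj_a_linear.

Definition weak_action : {bilinear H2 k -> coinv A -> coinv A} :=
  bilinext (fun i : bool =>
    if i return {linear coinv A -> coinv A} then conj_a else idfun).

Definition cocycle : {bilinear H2 k -> H2 k -> coinv A} :=
  bilinext (fun i : bool =>
    linext (fun j : bool => if i && j then square_a else 1)).

Lemma weak_action_basis (i : bool) r :
  weak_action (H2basis i) r = if i then conj_a r else r.
Proof. by rewrite /= /bilinext linext_basis; case: i. Qed.

Lemma cocycle_basis (i j : bool) :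
  cocycle (H2basis i) (H2basis j) = if i && j then square_a else 1.
Proof. by rewrite /= /bilinext linext_basis; exact: linext_basis. Qed.

(** The commutation rule (x.r) a = a r, which is what makes nu multiplicative. *)
Lemma conj_a_mul_a r : val (conj_a r) ** a = a ** val r.
Proof. exact: mul_odd_b_a (homog_a_mul r). Qed.

Lemma conj_a_mul_square r : val (conj_a r) ** val square_a = (a ** val r) ** a.
Proof.
have haa : homog false (a ** a) by exact: (homogM ha ha).
by rewrite /= (mulA_even (homog_a_mul r) hb haa) // mul_b_aa.
Qed.

Lemma crossed_mul_basis (i j : bool) r s :
  val (r * weak_action (H2basis i) s * cocycle (H2basis i) (H2basis j))
    ** unital_map a (H2basis (i (+) j)) =
  (val r ** unital_map a (H2basis i)) ** (val s ** unital_map a (H2basis j)).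
Proof.
rewrite weak_action_basis cocycle_basis !unital_map_basis.
case: i; case: j => /=; rewrite ?mulr1 ?ca_mul1r //.
- rewrite (mulA_even (hr r) (hr (conj_a s)) (hr square_a)) //.
  rewrite conj_a_mul_square (mulA_even (hr r) ha (homog_mul_a s)) //.
  by rewrite (mulA_even ha (hr s) ha).
- rewrite (mulA_even (hr r) (hr (conj_a s)) ha) // conj_a_mul_a.
  by rewrite (mulA_even (hr r) ha (hr s)).
- by rewrite (mulA_even (hr r) (hr s) ha).
Qed.

(** Since 1 is sent to 1, the general formulas for the weak action and the
    cocycle collapse on grouplikes; sigma(x, 1) = sigma(1, x) = ab = 1, and
    sigma(x, x) = (aa)1. *)
Lemma cleft_pair_crossed :
  crossed_structure (unital_map a) (unital_map b) weak_action cocycle.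
Proof.
split=> [h r|h g|].
- rewrite weak_action_sw3E {1}[h]H2_sum linear_sumlz linear_sum.
  apply: eq_bigr => i _; rewrite linearZl_LR weak_action_basis /=.
  by rewrite !unital_map_basis; case: i => //; rewrite ca_mul1l ca_mul1r.
- rewrite cocycle_sw3E {1}[h]H2_sum linear_sumlz linear_sum.
  apply: eq_bigr => i _; rewrite linearZl_LR linearZ; congr (_ *: _).
  rewrite {1}[g]H2_sum linear_sumr linear_sum.
  apply: eq_bigr => j _; rewrite linearZr_LR linearZ; congr (_ *: _).
  rewrite cocycle_basis !unital_map_basis.
  by case: i; case: j => /=; rewrite ?ca_mul1l ?ca_mul1r // cleft_pairV.
split; first exact: nu_linear.
- by exists nu_inv; [exact: nuK | exact: nu_invK].
- by rewrite nu_tens_basis unital_map_basis ca_mul1l.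
- exact/nu_crossed_mul/crossed_mul_basis.
Qed.

End CleftPair.

Theorem lemma37 (k : fieldType) (char_neq2 : 2%N \notin [pchar k])
    (A : comodAlg k) :
  (cleft A <-> exists a b : A, cleft_pair a b) /\
  (forall a b : A, cleft_pair a b ->
    [/\ cleaving_system (unital_map a) (unital_map b),
        module_basis (M := coinv_module A)
          (fun i : bool => if i then a else ca_one A),
        exists c d : coinv A,
          [/\ val c = a ** a, val d = - (b ** b), c * d = 1 & d * c = 1] &
        exists (wa : {bilinear H2 k -> coinv A -> coinv A})
               (sg : {bilinear H2 k -> H2 k -> coinv A}),
          [/\ crossed_structure (unital_map a) (unital_map b) wa sg,
              forall e : coinv A, wa 1 e = e,
              forall e : coinv A, val (wa H2x e) = (a ** val e) ** b,
              val (sg H2x H2x) = a ** a &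
              [/\ sg 1 1 = 1, sg 1 H2x = 1 & sg H2x 1 = 1]]]).
Proof.
split.
  split=> [[gamma [delta /cleaving_systemP/(_ true)]]|[a [b ab]]]; last first.
    by exists (unital_map a), (unital_map b); exact: cleft_pair_cleaving ab.
  case=> hg hd dg gd; exists (gamma H2x), (delta H2x).
  by split=> //; rewrite dg scaleN1r.
move=> a b ab; split.
- exact: cleft_pair_cleaving ab.
- exact: cleft_pair_basis ab.
- exists (square_a ab), (neg_square_b ab).
  by split=> //; [exact: square_aV | exact: square_aVl].
- exists (weak_action ab), (cocycle ab); split.
  + exact: cleft_pair_crossed.
  + exact: (weak_action_basis ab false).
  + by move=> e; rewrite (weak_action_basis ab true).
  + by rewrite (cocycle_basis ab true true).
  + split; [exact: (cocycle_basis ab false false) |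
            exact: (cocycle_basis ab false true) |
            exact: (cocycle_basis ab true false)].
Qed.
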